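(* Let $a\in\mathbb{R}$, let $\phi$ be a strictly increasing $C^1$ function on $[a,\infty)$ with $\phi'>0$ everywhere, and let $w$ be a nowhere-zero weight function on $[a,\infty)$. For functions $f,g:[a,\infty)\to\mathbb{C}$, the $w$-weighted $\phi$-convolution is related to classical convolution via $$f\ast_{\phi;w(x)}g=\Big(M_{w(x)}^{-1}\circ Q_{\phi(x)-\phi(a)}\Big)\left[\left(Q_{\phi(x)-\phi(a)}^{-1}\circ M_{w(x)}f\right)\ast\left(Q_{\phi(x)-\phi(a)}^{-1}\circ M_{w(x)}g\right)\right],$$ or equivalently, as binary operations, $$\ast_{\phi;w(x)}=M_{w(x)}^{-1}\circ Q_{\phi(x)-\phi(a)}\circ\ast\circ\left(Q_{\phi(x)-\phi(a)}^{-1}\circ M_{w(x)},\,Q_{\phi(x)-\phi(a)}^{-1}\circ M_{w(x)}\right).$$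
   Context: The $w$-weighted $\phi$-convolution of $f,g:[a,\infty)\to\mathbb{C}$ is (whenever the integral exists) $$\Big(f\ast_{\phi;w(x)}g\Big)(x)=\frac{1}{w(x)}\int_a^xw\Big(\phi^{-1}\big(\phi(x)+\phi(a)-\phi(t)\big)\Big)f\Big(\phi^{-1}\big(\phi(x)+\phi(a)-\phi(t)\big)\Big)w(t)g(t)\phi'(t)\,dt.$$ Classical (Laplace-type) convolution is $(u\ast v)(x)=\int_0^xu(x-t)v(t)\,dt$. $M_{w(x)}$ is multiplication by $w$: $(M_{w(x)}f)(x)=w(x)f(x)$. For a strictly increasing function $\psi$, $Q_\psi g=g\circ\psi$ and $Q_\psi^{-1}h=h\circ\psi^{-1}$; here $\psi(x)=\phi(x)-\phi(a)$. *)

(* Defs.v *)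
From mathcomp Require Import all_boot all_order all_algebra.
From mathcomp Require Import complex.
From mathcomp Require Import all_classical all_reals all_analysis.

Set Implicit Arguments.
Unset Strict Implicit.
Unset Printing Implicit Defensive.

Import Order.TTheory GRing.Theory Num.Theory.
Import numFieldNormedType.Exports.

Local Open Scope classical_set_scope.
Local Open Scope ring_scope.
Local Open Scope complex_scope.

(* A function on a set A of reals is represented by a total function on R of
   which only the values on A matter. *)

Section RelativeDerivative.
Variable R : realType.
Implicit Types (A : set R) (f : R -> R) (x : R).

(* Limits are taken inside A, so that the derivative of a function on [a, +oo[
   is two-sided at x > a and one-sided at a. *)
Definition diff_quot f x : R -> R := fun t => (f t - f x) / (t - x).

Definition derivable_on A f x : Prop :=
  cvg (diff_quot f x t @[t --> within A x^']).

Definition deriv_on A f x : R :=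
  lim (diff_quot f x t @[t --> within A x^']).

Definition C1_on A f : Prop :=
  (forall x, A x -> derivable_on A f x) /\
  {within A, continuous (deriv_on A f)}.

End RelativeDerivative.

Section ComplexIntegral.
Variable R : realType.
Implicit Types (D : set R) (h : R -> R[i]).

(* The completed measure is used because lebesgue_measure lives on the Borel
   sigma-algebra: here integrable functions need only be Lebesgue measurable. *)
Definition cintegrable D h : Prop :=
  (@completed_lebesgue_measure R).-integrable D (EFin \o (fun t => complex.Re (h t))) /\
  (@completed_lebesgue_measure R).-integrable D (EFin \o (fun t => complex.Im (h t))).

Definition cintegral D h : R[i] :=
  Rintegral (@completed_lebesgue_measure R) D (fun t => complex.Re (h t)) +i*
  Rintegral (@completed_lebesgue_measure R) D (fun t => complex.Im (h t)).

End ComplexIntegral.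

Section Convolutions.
Variable R : realType.
Implicit Types (u v f g w : R -> R[i]) (phi : R -> R) (a x : R).

(* Laplace-type convolution (the name conv is taken by convex combinations).
   At x it only samples u and v on [0, x], so it makes sense for functions on
   [0, L[ with L finite, e.g. when the range of phi is bounded. *)
Definition lconv_integrand u v x : R -> R[i] := fun t => u (x - t) * v t.

Definition lconv_exists u v x : Prop :=
  cintegrable `[0, x] (lconv_integrand u v x).

Definition lconv u v x : R[i] := cintegral `[0, x] (lconv_integrand u v x).

Definition inv_on a phi : R -> R := pinv `[a, +oo[ phi.

Definition wconv_integrand a phi w f g x : R -> R[i] := fun t =>
  w (inv_on a phi (phi x + phi a - phi t)) *
  f (inv_on a phi (phi x + phi a - phi t)) *
  w t * g t * (deriv_on `[a, +oo[ phi t)%:C.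

Definition wconv_exists a phi w f g x : Prop :=
  cintegrable `[a, x] (wconv_integrand a phi w f g x).

Definition wconv a phi w f g x : R[i] :=
  (w x)^-1 * cintegral `[a, x] (wconv_integrand a phi w f g x).

End Convolutions.

Section Operators.
Variable R : realType.
Implicit Types (w f g h : R -> R[i]) (psi : R -> R) (a x : R).

Definition opM w f : R -> R[i] := fun x => w x * f x.

Definition opM_inv w f : R -> R[i] := fun x => (w x)^-1 * f x.

Definition opQ psi g : R -> R[i] := g \o psi.

Definition opQ_inv a psi h : R -> R[i] := h \o inv_on a psi.

End Operators.

(* The pair (S, T) acting componentwise, as in * \o (S, T) for a binary
   operation * seen as a function on pairs. *)
Definition op_pair (X Y : Type) (S T : X -> Y) (p : X * X) : Y * Y :=
  (S p.1, T p.2).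

(* Main.v *)
From HB Require Import structures.
Require Import Defs.
From mathcomp Require Import all_boot all_order all_algebra.
From mathcomp Require Import complex ring lra.
From mathcomp Require Import all_classical all_reals all_analysis.
From mathcomp Require Import measurable_realfun simple_functions.
From mathcomp Require Import measurable_fun_approximation.

(** The substitution s = psi t = phi t - phi a turns the classical convolution
    integral over [0, psi x] into the weighted one over [a, x]. The functions
    are only Lebesgue measurable, so the substitution is carried out at the level
    of measures: psi, restricted to [a, x], is continued by its tangent lines to a
    C^1 diffeomorphism P of the real line with derivative rho > 0, and the measure
    with density rho is shown to push forward to Lebesgue measure along P. This
    holds on half-open intervals by the fundamental theorem of calculus, hence on
    Borel sets by uniqueness, hence on Lebesgue measurable sets since P and its
    inverse both preserve null sets. *)

Set Implicit Arguments.
Unset Strict Implicit.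
Unset Printing Implicit Defensive.

Import Order.TTheory GRing.Theory Num.Theory.
Import numFieldNormedType.Exports.
Import HBNNSimple.

Local Open Scope classical_set_scope.
Local Open Scope ring_scope.
Local Open Scope complex_scope.

(** * Change of variables for a measure given by a density along a map *)

Section density.
Local Open Scope ereal_scope.
Context d1 d2 (X : measurableType d1) (Y : measurableType d2) (R : realType).
Context (mu : {measure set X -> \bar R}) (nu : {measure set Y -> \bar R}).
Context (P : X -> Y) (rho : X -> R).
Hypothesis mP : measurable_fun setT P.
Hypothesis mrho : measurable_fun setT rho.
Hypothesis rho_ge0 : forall x, (0 <= rho x)%R.
Hypothesis nuE : forall A, measurable A ->
  nu A = \int[mu]_(x in P @^-1` A) (rho x)%:E.

(** Monotone convergence on both sides reduces the claim to simple functions and linearity reduces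
    it to indicators, where it is the hypothesis [nuE]. *)
Lemma ge0_integral_pushforward_density D (f : Y -> \bar R) :
  measurable D -> measurable_fun D f -> (forall y, D y -> 0 <= f y) ->
  \int[nu]_(y in D) f y = \int[mu]_(x in P @^-1` D) (f (P x) * (rho x)%:E).
Proof.
move=> mD mf f0.
have mPD A : measurable A -> measurable (P @^-1` A).
  by move=> mA; rewrite -(setTI (_ @^-1` _)); exact: mP.
have mEr E : measurable_fun E (EFin \o rho).
  exact/measurable_EFinP/measurable_funTS.
pose f_ := nnsfun_approx mD mf.
have mfP n : measurable_fun (P @^-1` D) (EFin \o f_ n \o P).
  apply/measurable_funTS/(measurableT_comp _ mP).
  exact/measurable_EFinP/measurable_funP.
transitivity (limn (fun n => \int[nu]_(x in D) (f_ n x)%:E)).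
  rewrite -monotone_convergence//.
  - apply: eq_integral => y /[!inE] yD; apply/esym/cvg_lim => //.
    exact: cvg_nnsfun_approx.
  - by move=> n; exact/measurable_EFinP/measurable_funP.
  - by move=> n y _; rewrite lee_fin.
  - by move=> y _ m n mn; rewrite lee_fin; exact/lefP/nd_nnsfun_approx.
(* The two sequences of integrals of simple functions are matched term by term; since [rho] is
   nonnegative, the products on the right still increase with [n]. *)
rewrite [X in limn X](_ : _ = (fun n =>
    \int[mu]_(x in P @^-1` D) ((f_ n (P x))%:E * (rho x)%:E))).
  rewrite -monotone_convergence//; last 4 first.
  - exact: mPD.
  - by move=> n; apply: emeasurable_funM; [exact: mfP|exact: mEr].
  - by move=> n x _; rewrite mule_ge0// lee_fin.
  - move=> x _ m n mn; rewrite lee_wpmul2r ?lee_fin//.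
    exact/lefP/nd_nnsfun_approx.
  apply: eq_integral => x /[!inE] Dx; apply/cvg_lim => //.
  by apply: cvgeZr => //; exact: cvg_nnsfun_approx.
apply/funext => n.
have mi r : measurable_fun D (fun y => (r * \1_(f_ n @^-1` [set r]) y)%:E).
  by apply/measurable_EFinP; exact: measurable_funM.
have miP r : measurable_fun (P @^-1` D)
    (fun x => (r * \1_(f_ n @^-1` [set r]) (P x))%:E).
  apply/measurable_EFinP; apply: measurable_funM => //.
  exact/measurable_funTS/(measurableT_comp _ mP).
transitivity (\int[nu]_(y in D)
    (\sum_(r \in range (f_ n)) (r * \1_(f_ n @^-1` [set r]) y)%:E)).
  by apply: eq_integral => t tE; rewrite fimfunE -fsumEFin.
rewrite ge0_integral_fsum//; last by move=> m y _; exact: nnfun_muleindic_ge0.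
transitivity (\int[mu]_(x in P @^-1` D) (\sum_(r \in range (f_ n))
    (r * \1_(f_ n @^-1` [set r]) (P x))%:E * (rho x)%:E)); last first.
  apply: eq_integral => x _; rewrite -ge0_mule_fsuml.
    by rewrite fsumEFin// -(fimfunE _ (P x)).
  by move=> y; exact: nnfun_muleindic_ge0.
rewrite ge0_integral_fsum//; last 3 first.
- exact: mPD.
- by move=> r; apply: emeasurable_funM; [exact: miP|exact: mEr].
- by move=> m x _; rewrite mule_ge0 ?lee_fin// -lee_fin nnfun_muleindic_ge0.
(* One level set remains for each value of the simple function. The value is nonnegative, so it can
   be pulled out of the integral. *)
apply: eq_fsbigr => r; rewrite inE => -[y0 _ <-].
set r' := f_ n y0.
rewrite integralZl_indic_nnsfun//.
under [RHS]eq_integral do rewrite EFinM -muleA.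
rewrite [RHS]ge0_integralZl//; last 4 first.
- exact: mPD.
- apply: emeasurable_funM; last exact: mEr.
  by apply/measurable_EFinP/measurable_funTS/(measurableT_comp _ mP).
- by move=> t _; rewrite mule_ge0 ?lee_fin.
- by rewrite lee_fin.
congr (_ * _); rewrite integral_indic// nuE; last exact: measurableI.
rewrite preimage_setI setIC integral_mkcondr.
apply: eq_integral => x _; rewrite epatch_indic muleC.
by rewrite /= !indicE.
Qed.

Lemma measurable_fun_density D (f : Y -> R) : measurable D ->
  measurable_fun D f ->
  measurable_fun (P @^-1` D) (fun x => (f (P x) * rho x)%R).
Proof.
move=> mD mf; apply: measurable_funM; last exact: measurable_funTS.
apply: (measurable_comp mD) => //; first by move=> _ [x Dx <-].
exact: measurable_funTS.
Qed.

Lemma integral_pushforward_density D (f : Y -> R) :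
  measurable D -> measurable_fun D f ->
  \int[nu]_(y in D) (f y)%:E =
  \int[mu]_(x in P @^-1` D) (f (P x) * rho x)%:E.
Proof.
move=> mD mf; have mEf : measurable_fun D (EFin \o f) by exact/measurable_EFinP.
rewrite integralE [RHS]integralE; congr (_ - _).
  rewrite ge0_integral_pushforward_density//; last exact: measurable_funepos.
  apply: eq_integral => x _; rewrite !funeposE /= EFinM.
  by rewrite maxe_pMl ?mul0e ?lee_fin//.
rewrite ge0_integral_pushforward_density//; last exact: measurable_funeneg.
apply: eq_integral => x _; rewrite !funenegE.
by rewrite maxe_pMl ?mul0e ?lee_fin// mulNe.
Qed.

(** The change of variables is applied to [|f|]: as [rho] is nonnegative, it passes through the
    absolute value. *)
Lemma integrable_pushforward_density D (f : Y -> R) :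
  measurable D -> measurable_fun D f ->
  nu.-integrable D (EFin \o f) <->
  mu.-integrable (P @^-1` D) (EFin \o (fun x => f (P x) * rho x)%R).
Proof.
move=> mD mf.
have E : \int[nu]_(y in D) `|(EFin \o f) y| =
    \int[mu]_(x in P @^-1` D) `|(EFin \o (fun x => f (P x) * rho x)%R) x|.
  rewrite (integral_pushforward_density mD (f := fun y => `|f y|%R)).
    by apply: eq_integral => x _; rewrite /= normrM (ger0_norm (rho_ge0 x)).
  exact: measurableT_comp.
split => /integrableP[_] h; apply/integrableP; split.
- exact/measurable_EFinP/measurable_fun_density.
- by rewrite -E.
- exact/measurable_EFinP.
- by rewrite E.
Qed.

End density.

(** * Passage between Borel and completed Lebesgue measure *)

Section completion.
Local Open Scope ereal_scope.
Context {R : realType}.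
Notation lambda := (@lebesgue_measure R).
Notation mu := (@completed_lebesgue_measure R).
Notation cara := (caratheodory_type (wlength (idfun : R -> R))^*%mu).

Lemma borel_completed_measurable (A : set R) :
  measurable A -> measurable (A : set cara).
Proof. exact: sub_caratheodory. Qed.

Lemma borel_completed_measurable_fun (D : set R) (f : R -> R) :
  measurable_fun setT f -> measurable_fun (D : set cara) (f : cara -> R).
Proof.
move=> mf; apply: measurable_funTS => _ B mB; rewrite setTI.
by apply: borel_completed_measurable; rewrite -[X in measurable X]setTI;
  exact: mf.
Qed.

(** The Caratheodory sigma-algebra is the completion of the Borel one, whose members have this
    form. *)
Lemma completed_measurableP (A : set cara) : measurable A ->
  exists B : set R, exists N : set R,
    [/\ measurable B, lambda.-negligible N & A = B `|` N].
Proof.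
have := @completed_caratheodory_measurable R.
rewrite g_sigma_completed_algebra_genE => <- -[B mB [N N0 <-]].
by exists B, N.
Qed.

Lemma negligible_completed (N : set R) :
  lambda.-negligible N -> mu.-negligible N.
Proof.
by move=> [B [mB B0 NB]]; exists B; split => //; exact: sub_caratheodory.
Qed.

(** The identity is measurable from the completed space to the Borel one, and Lebesgue measure is
    the image of its completion under it. *)
Lemma integral_completed (D : set R) (f : R -> \bar R) :
  measurable D -> measurable_fun D f -> (forall x, D x -> 0 <= f x) ->
  \int[lambda]_(x in D) f x = \int[mu]_(x in D) f x.
Proof.
move=> mD mf f0.
have mid : measurable_fun setT (idfun : cara -> measurableTypeR R).
  by move=> _ B mB; rewrite setTI; exact: borel_completed_measurable.
rewrite -(@ge0_integral_pushforward _ _ _ _ _ _ mid mu)//.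
by move=> x /[!inE]; exact: f0.
Qed.

End completion.

(** * Substitution along an increasing C^1 diffeomorphism of the line *)

Section diffeo.
Local Open Scope ereal_scope.
Context {R : realType}.
Variables (P Q rho : R -> R).
Hypothesis dP : forall t : R, is_derive t (1 : R)%R P (rho t).
Hypothesis crho : continuous rho.
Hypothesis rho_gt0 : forall t, (0 < rho t)%R.
Hypotheses (PK : cancel P Q) (QK : cancel Q P).
Notation lambda := (@lebesgue_measure R).
Notation mu := (@completed_lebesgue_measure R).
Notation cara := (caratheodory_type (wlength (idfun : R -> R))^*%mu).

Let cP : continuous P.
Proof.
move=> t; apply: differentiable_continuous; apply/derivable1_diffP.
by case: (dP t).
Qed.

Lemma gt0_deriv_lt_mono : {mono P : s t / (s < t)%R}.
Proof.
apply/leW_mono/le_mono => s t st.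
have [c _] := MVT st (fun x _ => dP x) (continuous_subspaceT cP).
by move=> e; rewrite -subr_gt0 e mulr_gt0// subr_gt0.
Qed.

Lemma gt0_deriv_inv_lt_mono : {mono Q : s t / (s < t)%R}.
Proof. by move=> s t; rewrite -gt0_deriv_lt_mono !QK. Qed.

Let mrho (D : set R) : measurable_fun D rho.
Proof. by apply: measurable_funTS; exact: continuous_measurable_fun. Qed.

Lemma integral_deriv s t : (s <= t)%R ->
  \int[lambda]_(x in `]s, t]) (rho x)%:E = (P t - P s)%:E.
Proof.
rewrite le_eqVlt => /predU1P[->|st].
  by rewrite set_itvoc0 integral_set0 subrr.
(* The endpoint [s] is a null set; adding it gives the closed interval on which the fundamental
   theorem of calculus applies. *)
rewrite integral_itv_obnd_cbnd; last exact/measurable_EFinP.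
rewrite (@continuous_FTC2 _ _ P)//.
- exact: continuous_subspaceT.
- split.
  + by move=> x _; case: (dP x).
  + exact/cvg_at_right_filter/cP.
  + exact/cvg_at_left_filter/cP.
- by move=> x _; rewrite derive1E; exact: derive_val.
Qed.

Let mErho (D : set (measurableTypeR R)) : measurable_fun D (EFin \o rho).
Proof. by apply/measurable_EFinP; exact: mrho. Qed.

Let mP : measurable_fun setT P.
Proof. exact: continuous_measurable_fun. Qed.

Let mQ : measurable_fun setT Q.
Proof.
apply: nondecreasing_measurable => // s t.
by rewrite !leNgt gt0_deriv_inv_lt_mono.
Qed.

Let mPpre (B : set R) : measurable B -> measurable (P @^-1` B).
Proof. by move=> mB; rewrite -[X in measurable X]setTI; exact: mP. Qed.

Let mQpre (B : set R) : measurable B -> measurable (Q @^-1` B).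
Proof. by move=> mB; rewrite -[X in measurable X]setTI; exact: mQ. Qed.

Let PQpre (A : set R) : P @^-1` (Q @^-1` A) = A.
Proof. by apply/funext => x; rewrite /preimage /= PK. Qed.

Let density (A : set R) : \bar R := \int[lambda]_(x in A) (rho x)%:E.

Let density0 : density (P @^-1` set0) = 0.
Proof. by rewrite preimage_set0 /density integral_set0. Qed.

Let density_ge0 A : 0 <= density (P @^-1` A).
Proof. by apply: integral_ge0 => x _; rewrite lee_fin ltW. Qed.

Let density_sigma : semi_sigma_additive (fun A => density (P @^-1` A)).
Proof.
move=> F mF tF mUF; rewrite /density preimage_bigcup.
rewrite ge0_integral_bigcup//=.
- by apply: (@is_cvg_nneseries _ _ xpredT 0%N) => n _ _; exact: density_ge0.
- by move=> n; exact: mPpre.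
- by move=> x _; rewrite lee_fin ltW.
- apply/trivIsetP => i j _ _ ij; rewrite -preimage_setI.
  by move/trivIsetP : tF => /(_ i j I I ij) ->; rewrite preimage_set0.
Qed.

(** The image along [P] of the measure with density [rho], made a measure so that the uniqueness of
    Lebesgue measure can be invoked. *)
Let nu (A : set (measurableTypeR R)) := density (P @^-1` A).

HB.instance Definition _ := isMeasure.Build _ _ _ nu
  density0 density_ge0 density_sigma.

Lemma lebesgue_measure_density (A : set R) : measurable A ->
  lambda A = \int[lambda]_(x in P @^-1` A) (rho x)%:E.
Proof.
move=> mA; rewrite (@lebesgue_measure_unique R nu)// => _ [[s t] _ <-].
rewrite -[RHS]/(density (P @^-1` `]s, t])) /density.
(* Monotonicity turns the preimage into a half-open interval, on which [rho] integrates to an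
   increment of [P]. *)
rewrite (_ : P @^-1` _ = `]Q s, Q t]%classic); last first.
  apply/funext => x; rewrite /preimage/= !in_itv/=.
  rewrite -(gt0_deriv_inv_lt_mono s) PK.
  by rewrite !(leNgt _ _) -(gt0_deriv_inv_lt_mono t) PK.
rewrite lebesgue_measure_itv/= lte_fin; case: ltP => st.
  by rewrite integral_deriv ?ltW ?gt0_deriv_inv_lt_mono// !QK EFinB.
rewrite set_itv_ge ?integral_set0// bnd_simp -leNgt.
by rewrite leNgt gt0_deriv_inv_lt_mono -leNgt.
Qed.

(** For a Borel null set [B], the density formula says that [rho] has integral zero over the
    preimage of [B]; as [rho] is positive, that preimage is null. *)
Lemma negligible_preimage (N : set R) :
  lambda.-negligible N -> lambda.-negligible (P @^-1` N).
Proof.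
move=> [B [mB B0 NB]]; exists (P @^-1` B); split; [exact: mPpre| |].
  move: B0; rewrite lebesgue_measure_density// => B0.
  have : ae_eq lambda (P @^-1` B) (EFin \o rho) (cst 0).
    apply/ae_eq_integral_abs; [exact: mPpre|exact: mErho|].
    by rewrite -B0; apply: eq_integral => x _; rewrite /= gtr0_norm.
  move=> [M [mM M0 BM]]; apply: (subset_measure0 _ _ _ M0) => //.
    exact: mPpre.
  move=> x Bx; apply: BM => /= /(_ Bx)[] /eqP.
  by rewrite gt_eqF.
exact: preimage_subset.
Qed.

(** By the density formula the measure of the preimage of [B] under [Q] is the integral of [rho]
    over [B] itself, hence zero. *)
Lemma negligible_preimage_inv (N : set R) :
  lambda.-negligible N -> lambda.-negligible (Q @^-1` N).
Proof.
move=> [B [mB B0 NB]]; exists (Q @^-1` B); split; [exact: mQpre| |].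
  rewrite lebesgue_measure_density; last exact: mQpre.
  rewrite PQpre null_set_integral//; exact: mErho.
exact: preimage_subset.
Qed.

Let mcP : measurable_fun setT (P : cara -> cara).
Proof.
move=> _ A /completed_measurableP[B [N [mB N0 ->]]]; rewrite setTI.
rewrite preimage_setU; apply: measurableU.
  by apply: borel_completed_measurable; exact: mPpre.
apply: negligible_sub_caratheodory.
exact/negligible_completed/negligible_preimage.
Qed.

Let mcQ : measurable_fun setT (Q : cara -> cara).
Proof.
move=> _ A /completed_measurableP[B [N [mB N0 ->]]]; rewrite setTI.
rewrite preimage_setU; apply: measurableU.
  by apply: borel_completed_measurable; exact: mQpre.
apply: negligible_sub_caratheodory.
exact/negligible_completed/negligible_preimage_inv.
Qed.

Let mcrho (D : set cara) : measurable_fun D (rho : cara -> R).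
Proof. by apply: borel_completed_measurable_fun; exact: mrho. Qed.

Let mcErho (D : set cara) : measurable_fun D (EFin \o rho : cara -> \bar R).
Proof. by apply/measurable_EFinP; exact: mcrho. Qed.

(** Removing a Borel null set [M] that covers the non-Borel part of [A] changes neither side and
    leaves a Borel set, for which the formula is known. *)
Lemma completed_measure_density (A : set cara) : measurable A ->
  mu A = \int[mu]_(x in P @^-1` A) (rho x)%:E.
Proof.
move=> mA; have mPA : measurable (P @^-1` A : set cara).
  by rewrite -[X in measurable X]setTI; exact: mcP.
have [B [N [mB [M [mM M0 NM]] AE]]] := completed_measurableP mA.
have mM' := borel_completed_measurable mM.
have mPM := borel_completed_measurable (mPpre mM).
have PM0 : mu (P @^-1` M) = 0.
  apply: measure_negligible => //; apply: negligible_completed.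
  by apply: negligible_preimage; exists M; split.
have ABM : A `\` M = B `\` M.
  by rewrite AE setDUl (_ : N `\` M = set0) ?setU0//; rewrite setD_eq0.
rewrite (measureDI _ mA mM') [X in _ + X](_ : _ = 0) ?adde0; last first.
  apply: (@subset_measure0 _ _ _ mu (A `&` M) M _ _ _ M0).
  - exact: measurableI.
  - exact: mM'.
  - exact: subIsetr.
rewrite (ge0_negligible_integral mPM)//; last first.
  by move=> x _; rewrite lee_fin ltW.
rewrite -[X in integral _ X _]/(P @^-1` (A `\` M)) ABM.
rewrite -integral_completed//; last 3 first.
- by apply: mPpre; exact: measurableD.
- exact: mErho.
- by move=> x _; rewrite lee_fin ltW.
by rewrite -lebesgue_measure_density//; exact: measurableD.
Qed.

Lemma integrable_substitution (E : set R) (f : R -> R) :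
  measurable (E : set cara) ->
  mu.-integrable E (EFin \o f) <->
  mu.-integrable (P @^-1` E) (EFin \o (fun x => f (P x) * rho x)%R).
Proof.
move=> mE; have mPE : measurable (P @^-1` E : set cara).
  by rewrite -[X in measurable X]setTI; exact: mcP.
have main := integrable_pushforward_density mcP (@mcrho setT)
  (fun x => ltW (rho_gt0 x)) completed_measure_density mE.
split => [fi|fi]; apply/main => //.
  by apply/measurable_EFinP; exact: measurable_int fi.
have mf : measurable_fun (P @^-1` E : set cara) (fun x => f (P x) * rho x)%R.
  by apply/measurable_EFinP; exact: measurable_int fi.
(* f is recovered from (f \o P) * rho by composing with Q and dividing. *)
have mV : measurable_fun (setT : set cara) (fun y => (rho y)^-1 : R)%R.
  apply: borel_completed_measurable_fun; apply: continuous_measurable_fun.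
  by move=> x; apply: cvgV; [rewrite gt_eqF|exact: crho].
have mVQ : measurable_fun (E : set cara) (fun y => (rho (Q y))^-1)%R.
  by apply: measurable_funTS; exact: (measurableT_comp mV mcQ).
have fE : {in (E : set cara),
    (fun y : cara => f (P (Q y)) * rho (Q y) * (rho (Q y))^-1)%R =1
    (f : cara -> R)}.
  by move=> y _; rewrite /= QK mulfK// gt_eqF.
apply: (eq_measurable_fun _ fE).
apply: measurable_funM => //.
apply: (measurable_comp mPE _ mf); last exact: measurable_funTS.
  by move=> _ [y Ey <-]; rewrite /preimage /= QK.
Qed.

Lemma integral_substitution (E : set R) (f : R -> R) :
  measurable (E : set cara) -> mu.-integrable E (EFin \o f) ->
  \int[mu]_(y in E) (f y)%:E =
  \int[mu]_(x in P @^-1` E) (f (P x) * rho x)%:E.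
Proof.
move=> mE fi; apply: (integral_pushforward_density mcP (@mcrho setT)
  (fun x => ltW (rho_gt0 x)) completed_measure_density mE).
by apply/measurable_EFinP; exact: measurable_int fi.
Qed.

End diffeo.

(** * Gluing two functions at a point *)

Section glue.
Context {R : realType}.
Implicit Types (f g F : R -> R) (c l t : R).

(** Links the library derivative to the punctured limits that define [deriv_on], through the
    Caratheodory slope function: the difference quotient filled in at [c] with [l]. *)
Lemma is_derive_diff_quotP F c l :
  is_derive c (1 : R) F l <-> diff_quot F c t @[t --> c^'] --> l.
Proof.
rewrite is_derive1_caratheodory; split=> [[g [gE gc gl]]|Fl].
  have /continuous_withinNx := gc; rewrite gl; apply: cvg_trans.
  apply: near_eq_cvg; near=> t; rewrite /diff_quot gE mulfK// subr_eq0.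
  by near: t; exact: nbhs_dnbhs_neq.
pose g t := if t == c then l else diff_quot F c t.
exists g; split; last by rewrite /g eqxx.
- move=> t; rewrite /g; case: eqVneq => [->|tc]; first by rewrite !subrr mulr0.
  by rewrite /diff_quot divfK// subr_eq0.
- apply/continuous_withinNx; rewrite {2}/g eqxx; apply: cvg_trans Fl.
  apply: near_eq_cvg; near=> t; rewrite /g ifF//; apply/negbTE.
  by near: t; exact: nbhs_dnbhs_neq.
Unshelve. all: by end_near. Qed.

Definition glue f g c t := if t < c then f t else g t.

Lemma glue_lt f g c t : t < c -> \forall s \near t, glue f g c s = f s.
Proof.
by move=> tc; near=> s; rewrite /glue ifT//; near: s; exact: lt_nbhsl.
Unshelve. all: by end_near. Qed.

Lemma glue_gt f g c t : c < t -> \forall s \near t, glue f g c s = g s.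
Proof.
move=> tc; near=> s; rewrite /glue ltNge ifF//; apply/negbTE; rewrite negbK ltW//.
by near: s; exact: lt_nbhsr.
Unshelve. all: by end_near. Qed.

Lemma continuous_glue f g c : f c = g c ->
  (forall t, t < c -> {for t, continuous f}) -> f t @[t --> c^'-] --> f c ->
  (forall t, c < t -> {for t, continuous g}) -> g t @[t --> c^'+] --> g c ->
  continuous (glue f g c).
Proof.
move=> fg fc fl gc gl t; have [tc|ct|->] := ltgtP t c.
- have := fc _ tc; rewrite /continuous_at {2}/glue tc => h.
  apply: cvg_trans h; apply: near_eq_cvg.
  by have := glue_lt f g tc; apply: filterS => s ->.
- have := gc _ ct; rewrite /continuous_at {2}/glue ltNge (ltW ct)/= => h.
  apply: cvg_trans h; apply: near_eq_cvg.
  by have := glue_gt f g ct; apply: filterS => s ->.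
- apply/left_right_continuousP; rewrite {2 4}/glue ltxx; split.
  + rewrite -fg; apply: cvg_trans fl; apply: near_eq_cvg.
    near=> s; rewrite /glue ifT//.
  + apply: cvg_trans gl; apply: near_eq_cvg.
    near=> s; rewrite /glue ltNge ifF//; apply/negbTE; rewrite negbK ltW//.
Unshelve. all: by end_near. Qed.

(** Away from [c] the glued function agrees locally with one branch; at [c] the two one-sided
    difference quotients have the same limit. *)
Lemma is_derive_glue f g (df dg : R -> R) c : f c = g c -> df c = dg c ->
  (forall t, t < c -> is_derive t (1 : R) f (df t)) ->
  diff_quot f c t @[t --> c^'-] --> df c ->
  (forall t, c < t -> is_derive t (1 : R) g (dg t)) ->
  diff_quot g c t @[t --> c^'+] --> dg c ->
  forall t, is_derive t (1 : R) (glue f g c) (glue df dg c t).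
Proof.
move=> fg dfg df_lt df_c dg_gt dg_c t; apply/is_derive_diff_quotP.
have [tc|ct|->] := ltgtP t c.
- have /is_derive_diff_quotP := df_lt _ tc.
  rewrite {2}/glue tc; apply: cvg_trans; apply: near_eq_cvg.
  apply: nbhs_dnbhs.
  have := glue_lt f g tc; apply: filterS => s; rewrite /diff_quot => ->.
  by rewrite /glue tc.
- have /is_derive_diff_quotP := dg_gt _ ct.
  rewrite {2}/glue ltNge (ltW ct)/=; apply: cvg_trans; apply: near_eq_cvg.
  apply: nbhs_dnbhs.
  have := glue_gt f g ct; apply: filterS => s; rewrite /diff_quot => ->.
  by rewrite /glue ltNge (ltW ct).
- rewrite {2}/glue ltxx; apply: (@cvg_at_right_left_dnbhs _ R^o).
  + apply: cvg_trans dg_c; apply: near_eq_cvg; near=> s.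
    rewrite /diff_quot /glue ltxx ltNge ifF//; apply/negbTE; rewrite negbK ltW//.
  + rewrite -dfg; apply: cvg_trans df_c; apply: near_eq_cvg; near=> s.
    by rewrite /diff_quot /glue ltxx -fg ifT.
Unshelve. all: by end_near. Qed.

Lemma is_derive_affine (k l c t : R) :
  is_derive t (1 : R) (fun s => k + l * (s - c)) l.
Proof.
apply/is_derive_diff_quotP; apply: (@cvg_trans _ (cst l @ t^')).
  apply: near_eq_cvg; near=> s.
  rewrite /diff_quot /cst/= opprD addrACA subrr add0r -mulrBr.
  rewrite opprB addrA subrK mulfK// subr_eq0.
  by near: s; exact: nbhs_dnbhs_neq.
exact: cvg_cst.
Unshelve. all: by end_near. Qed.

End glue.

(** * Extension of a C^1 function on an interval to a diffeomorphism of the line *)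

Section extension.
Context {R : realType}.
Implicit Types (a x t : R) (phi : R -> R).

Lemma diff_quot_shift phi (k : R) :
  diff_quot (fun t => phi t - k) = diff_quot phi.
Proof.
by apply/funext => s; apply/funext => t; rewrite /diff_quot opprB addrA subrK.
Qed.

Lemma C1_on_shift (A : set R) phi (k : R) :
  C1_on A phi -> C1_on A (fun t => phi t - k).
Proof. by rewrite /C1_on /derivable_on /deriv_on diff_quot_shift. Qed.

Lemma deriv_on_shift (A : set R) phi (k : R) :
  deriv_on A (fun t => phi t - k) = deriv_on A phi.
Proof. by rewrite /deriv_on diff_quot_shift. Qed.

Lemma C1_on_is_derive a phi t : C1_on `[a, +oo[ phi -> a < t ->
  is_derive t (1 : R) phi (deriv_on `[a, +oo[ phi t).
Proof.
move=> [dphi _] at_; apply/is_derive_diff_quotP.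
have /dphi : `[a, +oo[%classic t by rewrite /= in_itv/= andbT ltW.
apply: cvg_trans; apply: cvg_app => A h.
(* Since [a < t], the points near [t] all lie in the half-line, so the limit within it is the
   two-sided one. *)
have {}h : \forall s \near t, s != t -> `[a, +oo[%classic s -> A s by exact: h.
change (\forall s \near t, s != t -> A s).
apply: filterS2 (lt_nbhsr at_) h => s a_s h st; apply: h => //.
by rewrite /= in_itv/= andbT ltW.
Qed.

Lemma C1_on_right_derive a phi : C1_on `[a, +oo[ phi ->
  diff_quot phi a t @[t --> a^'+] --> deriv_on `[a, +oo[ phi a.
Proof.
move=> [dphi _]; have /dphi : `[a, +oo[%classic a by rewrite /= in_itv/= lexx.
apply: cvg_trans; apply: cvg_app => A h.
have {}h : \forall s \near a, s != a -> `[a, +oo[%classic s -> A s by exact: h.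
change (\forall s \near a, a < s -> A s).
apply: filterS h => s h a_s; apply: h; first by rewrite gt_eqF.
by rewrite /= in_itv/= andbT ltW.
Qed.

(** The tangent line at [a] is used to the left of [a]. Its explicit formula is kept in the
    conclusion because surjectivity of the full extension relies on it. *)
Lemma C1_extension_left a phi : C1_on `[a, +oo[ phi ->
  (forall t, a <= t -> 0 < deriv_on `[a, +oo[ phi t) ->
  exists F r : R -> R,
    [/\ forall t, is_derive t (1 : R) F (r t), continuous r,
        forall t, 0 < r t,
        forall t, a <= t -> F t = phi t /\ r t = deriv_on `[a, +oo[ phi t &
        forall t, t < a -> F t = phi a + r a * (t - a)].
Proof.
move=> phi_C1 dphi_gt0; set d := deriv_on _ _ in dphi_gt0 *.
have [_ /continuous_within_itvcyP[dc da]] := phi_C1.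
exists (glue (fun t => phi a + d a * (t - a)) phi a), (glue (cst (d a)) d a).
split.
- apply: is_derive_glue.
  + by rewrite subrr mulr0 addr0.
  + by [].
  + by move=> s _; exact: is_derive_affine.
  + have /is_derive_diff_quotP := is_derive_affine (phi a) (d a) a a.
    exact: cvg_dnbhs_at_left.
  + by move=> s; exact: C1_on_is_derive.
  + exact: C1_on_right_derive.
- apply: continuous_glue => //.
  + by move=> t _; exact: cvg_cst.
  + exact: cvg_cst.
  + by move=> t at_; apply: dc; rewrite in_itv/= at_.
- by move=> t; rewrite /glue /cst; have [_|at_] := ltP t a; apply: dphi_gt0.
- by move=> t at_; rewrite /glue ltNge at_.
- by move=> t ta; rewrite /glue ta ltxx.
Qed.

(** Cutting at [x] and continuing by the tangent line makes both ends affine of positive slope, so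
    the extension is onto even when [phi] is bounded. *)
Lemma C1_extension a x phi : a <= x -> C1_on `[a, +oo[ phi ->
  (forall t, a <= t -> 0 < deriv_on `[a, +oo[ phi t) ->
  exists P Q rho : R -> R,
    [/\ forall t, is_derive t (1 : R) P (rho t), continuous rho,
        forall t, 0 < rho t, cancel P Q /\ cancel Q P &
        {in `[a, x], forall t, P t = phi t /\ rho t = deriv_on `[a, +oo[ phi t}].
Proof.
move=> ax phi_C1 dphi_gt0.
have [F [r [dF cr r_gt0 Fr Fa]]] := C1_extension_left phi_C1 dphi_gt0.
pose P := glue F (fun t => F x + r x * (t - x)) x.
pose rho := glue r (cst (r x)) x.
have dP t : is_derive t (1 : R) P (rho t).
  apply: is_derive_glue.
  - by rewrite subrr mulr0 addr0.
  - by [].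
  - have /is_derive_diff_quotP := dF x.
    exact: cvg_dnbhs_at_left.
  - by move=> s _; exact: is_derive_affine.
  - have /is_derive_diff_quotP := is_derive_affine (F x) (r x) x x.
    exact: cvg_dnbhs_at_right.
have crho : continuous rho.
  apply: continuous_glue => //.
  - by move=> t _; exact: cr.
  - exact/cvg_at_left_filter/cr.
  - by move=> t _; exact: cvg_cst.
  - exact: cvg_cst.
have rho_gt0 t : 0 < rho t.
  by rewrite /rho /glue /cst; case: (ltP t x) => _; exact: r_gt0.
have cP : continuous P.
  move=> t; apply: differentiable_continuous; apply/derivable1_diffP.
  by case: (dP t).
have surjP y : exists t, P t = y.
  (* [t1] and [t2] lie on the two tangent lines, at distances chosen to put the value of [P] below
     [y] and above [y]; the intermediate value theorem then applies. *)
  pose t1 := a - (`|y - phi a| + 1) / r a.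
  pose t2 := x + (`|y - F x| + 1) / r x.
  have t1a : t1 < a by rewrite ltrBlDr ltrDl divr_gt0.
  have xt2 : x < t2 by rewrite ltrDl divr_gt0.
  have Pt1 : P t1 = phi a - (`|y - phi a| + 1).
    rewrite /P /glue (lt_le_trans t1a ax) Fa// /t1 addrAC subrr add0r.
    by rewrite mulrN mulrC divfK// gt_eqF.
  have Pt2 : P t2 = F x + (`|y - F x| + 1).
    rewrite /P /glue ltNge (ltW xt2)/= /t2 addrAC subrr add0r.
    by rewrite mulrC divfK// gt_eqF.
  have t12 : t1 <= t2 by rewrite ltW// (lt_le_trans t1a)// (le_trans ax)// ltW.
  have := @IVT R P t1 t2 y t12 (continuous_subspaceT cP).
  have y1 : P t1 <= y.
    by rewrite Pt1; have := ler_norm (phi a - y); rewrite distrC; lra.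
  have y2 : y <= P t2 by rewrite Pt2; have := ler_norm (y - F x); lra.
  rewrite (min_idPl (le_trans y1 y2)) (max_idPr (le_trans y1 y2)) y1 y2.
  by move=> /(_ isT)[t _ Pt]; exists t.
have [Q QK] := choice surjP.
have PK : cancel P Q.
  by move=> t; case: (ltgtP (Q (P t)) t) => //;
    rewrite -(gt0_deriv_lt_mono dP rho_gt0) QK ltxx.
exists P, Q, rho; split => // t; rewrite in_itv/= => /andP[at_ tx].
have [<- <-] := Fr t at_.
(* Only [t = x] remains: there the gluing selects the tangent line, which passes through the point
   of the graph. *)
rewrite /P /rho /glue; case: ltP => // xt.
have -> : t = x by apply/eqP; rewrite eq_le tx xt.
by rewrite subrr mulr0 addr0.
Qed.

End extension.

(** * Comparison of the weighted and the classical convolution *)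

Lemma wconv_lconv_integrand (R : realType) (a x : R) (phi : R -> R)
    (w f g : R -> R[i]) (P Q rho : R -> R) :
  let psi t := phi t - phi a in
  a <= x -> {in `[a, +oo[ &, injective phi} ->
  {mono P : s t / s < t} -> cancel Q P ->
  {in `[a, x], forall t, P t = psi t /\ rho t = deriv_on `[a, +oo[ phi t} ->
  {in `[a, x], forall t, wconv_integrand a phi w f g x t =
    lconv_integrand ((opQ_inv a psi \o opM w) f) ((opQ_inv a psi \o opM w) g)
      (psi x) (P t) * (rho t)%:C}.
Proof.
move=> psi ax phi_inj P_lt QK PE t tax.
have P_le : {mono P : s t / s <= t} by move=> s r; rewrite !leNgt P_lt.
have ge_in s : a <= s -> s \in `[a, +oo[%classic.
  by move=> as_; rewrite inE/= in_itv/= andbT.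
(* [inv_on] is a partial inverse, a true one only thanks to injectivity on the half-line. *)
have invphi s : a <= s -> inv_on a phi (phi s) = s.
  move=> as_; rewrite /inv_on pinvKV// ?ge_in// => u v; rewrite !inE => *.
  exact: phi_inj.
have invpsi s : a <= s -> inv_on a psi (psi s) = s.
  move=> as_; rewrite /inv_on pinvKV ?ge_in// => u v.
  rewrite !inE/= => ua va /addIr; exact: phi_inj.
have Ea : a \in `[a, x] by rewrite in_itv/= lexx.
have Ex : x \in `[a, x] by rewrite in_itv/= lexx ax.
have [at_ tx] : a <= t /\ t <= x by move: tax; rewrite in_itv/= => /andP[].
have [Pa _] := PE _ Ea; have [Px _] := PE _ Ex; have [Pt rhot] := PE _ tax.
have psia : psi a = 0 by rewrite /psi subrr.
(* [y] is the reflected point, with [psi y = psi x - psi t]. It lies in [[a, x]], so both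
   [inv_on a phi] at [phi x + phi a - phi t] and [inv_on a psi] at [psi x - psi t] return it. *)
pose y := Q (psi x - psi t).
have Py : P y = psi x - psi t by rewrite QK.
have yax : y \in `[a, x].
  rewrite in_itv/= -(P_le a) -(P_le y) Py Pa Px psia subr_ge0 gerBl.
  by rewrite -Px -Pt P_le tx -psia -Pa P_le at_.
have ay : a <= y by move: yax; rewrite in_itv/= => /andP[].
have [Py' _] := PE _ yax.
have phiy : phi x + phi a - phi t = phi y.
  move: Py; rewrite Py' /psi => /(congr1 (+%R^~ (phi a))); rewrite subrK => ->.
  by ring.
rewrite /wconv_integrand /lconv_integrand /opQ_inv /opM /= Pt.
by rewrite -Py Py' !invpsi// phiy invphi// rhot !mulrA.
Qed.

Section change_of_variable_conv.
Context {R : realType}.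
Variables (a : R) (phi : R -> R) (w : R -> R[i]).
Hypothesis phi_incr : forall x y : R, a <= x -> x < y -> phi x < phi y.
Hypothesis phi_C1 : C1_on `[a, +oo[ phi.
Hypothesis dphi_gt0 : forall x : R, a <= x -> 0 < deriv_on `[a, +oo[ phi x.

Notation mu := (@completed_lebesgue_measure R).
Notation cara := (caratheodory_type (wlength (idfun : R -> R))^*%mu).

(** The substitution along the extension of [psi] is applied separately to the real and imaginary
    parts of the integrands. *)
Lemma wconv_lconv (f g : R -> R[i]) (x : R) : a <= x ->
  let psi := fun x : R => phi x - phi a in
  let u := (opQ_inv a psi \o opM w) f in
  let v := (opQ_inv a psi \o opM w) g in
  (wconv_exists a phi w f g x <-> lconv_exists u v (psi x)) /\
  (wconv_exists a phi w f g x ->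
     cintegral `[a, x] (wconv_integrand a phi w f g x) = lconv u v (psi x)).
Proof.
move=> ax psi u v.
have dpsi_gt0 t : a <= t -> 0 < deriv_on `[a, +oo[ psi t.
  by move=> at_; rewrite /psi deriv_on_shift; exact: dphi_gt0.
have [P [Q [rho [dP crho rho_gt0 [PK QK]]]]] :=
  C1_extension ax (C1_on_shift (phi a) phi_C1) dpsi_gt0.
rewrite deriv_on_shift => PE.
have PltE := gt0_deriv_lt_mono dP rho_gt0.
have P_le : {mono P : s t / s <= t} by move=> s r; rewrite !leNgt PltE.
have phi_inj : {in `[a, +oo[ &, injective phi}.
  move=> s t; rewrite !in_itv/= !andbT => as_ at_ st.
  by apply/eqP; case: ltgtP => // h;
    [have := phi_incr as_ h|have := phi_incr at_ h]; rewrite st ltxx.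
have HE := wconv_lconv_integrand w f g ax phi_inj PltE QK PE.
set H := lconv_integrand u v (psi x) in HE *.
have preE : P @^-1` `[0, psi x] = `[a, x]%classic.
  have [Pa _] := PE a ltac:(by rewrite in_itv/= lexx).
  have [Px _] := PE x ltac:(by rewrite in_itv/= lexx ax).
  apply/funext => t; rewrite /preimage/= !in_itv/=
    -[psi x]/(phi x - phi a) -Px -[0](subrr (phi a)) -Pa.
  by rewrite !P_le.
have mE : measurable (`[0, psi x] : set cara).
  by apply: borel_completed_measurable; exact: measurable_itv.
have mD : measurable (`[a, x] : set cara).
  by apply: borel_completed_measurable; exact: measurable_itv.
have subst (h k : R -> R) :
    {in `[a, x]%classic, k =1 (fun t => h (P t) * rho t)} ->
    (mu.-integrable `[a, x] (EFin \o k) <->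
     mu.-integrable `[0, psi x] (EFin \o h)) /\
    (mu.-integrable `[0, psi x] (EFin \o h) ->
     Rintegral mu `[a, x] k = Rintegral mu `[0, psi x] h).
  move=> kE; have kE' : {in `[a, x]%classic,
      EFin \o k =1 EFin \o (fun t => h (P t) * rho t)}.
    by move=> t tax; rewrite /= kE.
  have ih := integrable_substitution dP crho rho_gt0 PK QK h mE.
  rewrite preE in ih; split; first split.
  - by move=> /(eq_integrable mD _ _ kE') /ih.
  - move=> /ih hi; apply: (eq_integrable mD _ _ _ hi) => t tax.
    by rewrite kE'.
  - move=> hi; rewrite /Rintegral.
    rewrite (integral_substitution dP crho rho_gt0 PK QK mE hi) preE.
    by congr fine; apply: eq_integral.
(* The factor [rho] is real, so taking real or imaginary parts commutes with multiplication by
   it. *)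
have ReE : {in `[a, x]%classic,
    (fun t => complex.Re (wconv_integrand a phi w f g x t)) =1
    (fun t => complex.Re (H (P t)) * rho t)}.
  move=> t; rewrite inE => tax; rewrite /= HE//.
  by case: (H (P t)) => p q /=; rewrite mulr0 subr0.
have ImE : {in `[a, x]%classic,
    (fun t => complex.Im (wconv_integrand a phi w f g x t)) =1
    (fun t => complex.Im (H (P t)) * rho t)}.
  move=> t; rewrite inE => tax; rewrite /= HE//.
  by case: (H (P t)) => p q /=; rewrite mulr0 add0r.
have [reE reI] := subst (fun s => complex.Re (H s)) _ ReE.
have [imE imI] := subst (fun s => complex.Im (H s)) _ ImE.
split; first by split=> -[/reE re /imE im].
by move=> [/reE re /imE im]; rewrite /lconv /cintegral reI// imI.
Qed.

End change_of_variable_conv.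

Theorem theorem4p4 (R : realType) (a : R) (phi : R -> R) (w : R -> R[i])
  (phi_incr : forall x y : R, a <= x -> x < y -> phi x < phi y)
  (phi_C1 : C1_on `[a, +oo[ phi)
  (dphi_gt0 : forall x : R, a <= x -> 0 < deriv_on `[a, +oo[ phi x)
  (w_neq0 : forall x : R, a <= x -> w x != 0) :
  let psi := fun x : R => phi x - phi a in
  (forall (f g : R -> R[i]) (x : R), a <= x ->
     (wconv_exists a phi w f g x <->
      lconv_exists ((opQ_inv a psi \o opM w) f) ((opQ_inv a psi \o opM w) g)
        (psi x)) /\
     (wconv_exists a phi w f g x ->
      wconv a phi w f g x =
      (opM_inv w \o opQ psi)
        (lconv ((opQ_inv a psi \o opM w) f) ((opQ_inv a psi \o opM w) g)) x))
  /\
  (forall (p : (R -> R[i]) * (R -> R[i])) (x : R), a <= x ->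
     wconv_exists a phi w p.1 p.2 x ->
     uncurry (wconv a phi w) p x =
     (opM_inv w \o opQ psi \o uncurry (@lconv R) \o
        op_pair (opQ_inv a psi \o opM w) (opQ_inv a psi \o opM w)) p x).
Proof.
have conv f g x (ax : a <= x) :=
  wconv_lconv w phi_incr phi_C1 dphi_gt0 f g ax.
move=> psi; split.
  move=> f g x /(conv f g)[exE intE]; split=> // /intE eqI.
  by rewrite /wconv eqI.
(* On an explicit pair the operator identity unfolds to the pointwise one. *)
by move=> [f g] x /(conv f g)[_ intE] /intE eqI; rewrite /= /wconv eqI.
Qed.
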